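(* Let $\mathcal U$ be a countably infinite set of constants and consider relational databases $B=\langle R_1,\dots,R_n\rangle$ of finite relations over $\mathcal U$, with predicate symbols $r_1,\dots,r_n$ naming them. For every domain-independent constraint $c$ (a closed first-order formula), every relation symbol $r$, every domain-independent first-order formula $\Phi(\overline x)$ with free variables $\overline x$ (of the arity of $r$), every domain-independent first-order sentence $cond$, and all instructions $i_1,i_2,inst1,inst2$ of the update language, the following formulas are weakest preconditions for the indicated instruction and constraint $c$: 1. $wp(\texttt{foreach }\overline x:\Phi(\overline x)\texttt{ do }insert_R(\overline x),\,c)=c[r\rightarrow r\cup\Phi]$; 2. $wp(\texttt{foreach }\overline x:\Phi(\overline x)\texttt{ do }delete_R(\overline x),\,c)=c[r\rightarrow r-\Phi]$; 3. $wp((i_1;i_2),c)=wp(i_1,wp(i_2,c))$; 4. $wp(\texttt{if }cond\texttt{ then }inst1\texttt{ else }inst2,\,c)=\big(cond\wedge wp(inst1,c)\big)\vee\big(\neg cond\wedge wp(inst2,c)\big)$.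
   Context: An update maps a database $B=\langle R_1,\dots,R_n\rangle$ to $u(B)=\langle R_1',\dots,R_n'\rangle$ with $R_i'$ of the same arity as $R_i$. Instructions are built as: $I_1$: $\texttt{foreach }\overline x:\Phi(\overline x)\texttt{ do }insert_R(\overline x)$; $I_2$: $\texttt{foreach }\overline x:\Phi(\overline x)\texttt{ do }delete_R(\overline x)$; $I_3$: if $i_1,i_2$ are instructions, $(i_1;i_2)$ is an instruction; $I_4$: $\texttt{if }cond\texttt{ then }inst1\texttt{ else }inst2$ (else-branch optional), where $\Phi$ is a domain-independent first-order formula and $cond$ a domain-independent first-order sentence. Semantics: $I_1(B)=B[R\rightarrow R\cup\{\overline x\mid B\models\Phi(\overline x)\}]$; $I_2(B)=B[R\rightarrow R-\{\overline x\mid B\models\Phi(\overline x)\}]$; $(i_1;i_2)(B)=i_2(i_1(B))$; $I_4(B)=inst1(B)$ if $B\models cond$ and $inst2(B)$ if $B\models\neg cond$. Here $B[R\rightarrow R']$ is $B$ with relation $R$ replaced by $R'$. For a formula $c$, $c[r\rightarrow r\cup\phi]$ (resp. $c[r\rightarrow r-\phi]$) is obtained by substituting $r(\overline s)\vee\phi(\overline s)$ (resp. $r(\overline s)\wedge\neg\phi(\overline s)$) for every occurrence of $r(\overline s)$ in $c$. A formula $f$ is a precondition for update $u$ and constraint $c$ if for every database $B$, $B\models f$ implies $u(B)\models c$ (regardless of whether $B\models c$). $f$ is weaker than $g$ if for every $B$, $B\models g$ implies $B\models f$. A weakest precondition for $(u,c)$ is a precondition weaker than every precondition for $(u,c)$.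 *)

(* Defs.v *)
From mathcomp Require Import all_boot.
From mathcomp Require Import boolp classical_sets cardinality.

Set Implicit Arguments.
Unset Strict Implicit.
Unset Printing Implicit Defensive.

Local Open Scope classical_set_scope.

(* First-order formulas with equality over a relational vocabulary
   ('I_n, ar) and constants from U.  Syntax is well-scoped de Bruijn:
   [formula k] has its free variables among x_0, ..., x_(k-1), and a
   quantifier binds variable 0 of its body.  A formula Phi(xbar) with xbar
   of the arity of r is thus a [formula (ar r)], a sentence a [formula 0]. *)

Inductive term (U : Type) (k : nat) : Type :=
| Var of 'I_k
| Cst of U.
Arguments Var {U k} _.
Arguments Cst {U k} _.

Inductive formula (U : Type) {n : nat} (ar : 'I_n -> nat) : nat -> Type :=
| FRel k (i : 'I_n) (s : (ar i).-tuple (term U k)) : formula U ar k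
| FEq k (s t : term U k) : formula U ar k
| FNot k (f : formula U ar k) : formula U ar k
| FAnd k (f g : formula U ar k) : formula U ar k
| FOr k (f g : formula U ar k) : formula U ar k
| FEx k (f : formula U ar k.+1) : formula U ar k
| FAll k (f : formula U ar k.+1) : formula U ar k.
Arguments FRel {U n ar k} i s.
Arguments FEq {U n ar k} s t.

Notation sentence U ar := (formula U ar 0).

Record db (U : Type) {n : nat} (ar : 'I_n -> nat) := Db {
  rel :> forall i : 'I_n, set ((ar i).-tuple U);
  rel_finite : forall i, finite_set (@rel i) }.
Arguments rel {U n ar} _ _ _.

Definition teval (U : Type) k (e : k.-tuple U) (t : term U k) : U :=
  match t with Var j => tnth e j | Cst a => a end.

(* Satisfaction with the quantifiers ranging over the domain D. *)
Fixpoint sat_in (U : Type) n (ar : 'I_n -> nat) (D : set U) (B : db U ar)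
    k (f : formula U ar k) : k.-tuple U -> Prop :=
  match f with
  | FRel _ i s => fun e => B i (map_tuple (teval e) s)
  | FEq _ s t => fun e => teval e s = teval e t
  | FNot _ f => fun e => ~ sat_in D B f e
  | FAnd _ f g => fun e => sat_in D B f e /\ sat_in D B g e
  | FOr _ f g => fun e => sat_in D B f e \/ sat_in D B g e
  | FEx _ f => fun e => exists2 a, D a & sat_in D B f [tuple of a :: e]
  | FAll _ f => fun e => forall a, D a -> sat_in D B f [tuple of a :: e]
  end.

Definition sat (U : Type) n (ar : 'I_n -> nat) (B : db U ar)
    k (f : formula U ar k) (e : k.-tuple U) : Prop := sat_in setT B f e.

Definition models (U : Type) n (ar : 'I_n -> nat) (B : db U ar)
    (c : sentence U ar) : Prop := sat B c [tuple].

Definition adom (U : eqType) n (ar : 'I_n -> nat) (B : db U ar) : set U :=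
  [set a | exists i, exists2 t, B i t & a \in t].

Definition tconsts (U : Type) k (t : term U k) : set U :=
  match t with Var _ => set0 | Cst a => [set a] end.

Fixpoint consts (U : Type) n (ar : 'I_n -> nat) k (f : formula U ar k)
    : set U :=
  match f with
  | FRel _ i s => [set a | exists j, tconsts (tnth s j) a]
  | FEq _ s t => tconsts s `|` tconsts t
  | FNot _ f => consts f
  | FAnd _ f g => consts f `|` consts g
  | FOr _ f g => consts f `|` consts g
  | FEx _ f => consts f
  | FAll _ f => consts f
  end.

Definition answers_in (U : Type) n (ar : 'I_n -> nat) (D : set U)
    (B : db U ar) k (f : formula U ar k) : set (k.-tuple U) :=
  [set t | (forall j, D (tnth t j)) /\ sat_in D B f t].

(* As usual in first-order logic, domains are nonempty. *)
Definition domain_independent (U : eqType) n (ar : 'I_n -> nat)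
    k (f : formula U ar k) : Prop :=
  forall (B : db U ar) (D D' : set U), D !=set0 -> D' !=set0 ->
    adom B `|` consts f `<=` D -> adom B `|` consts f `<=` D' ->
    answers_in D B f = answers_in D' B f.

Definition answers (U : Type) n (ar : 'I_n -> nat) (B : db U ar)
    k (f : formula U ar k) : set (k.-tuple U) := [set t | sat B f t].

Lemma finite_adom (U : eqType) n (ar : 'I_n -> nat) (B : db U ar) :
  finite_set (adom B).
Proof.
have -> : adom B = \bigcup_(i in [set: 'I_n]) \bigcup_(t in B i) [set` val t].
  apply/seteqP; split=> a.
    by case=> i [t Bt at_]; exists i => //; exists t.
  by case=> i _ [t Bt at_]; exists i, t.
apply: bigcup_finite => [|i _]; first exact: finite_finset.
by apply: bigcup_finite => [|t _]; [exact: rel_finite|exact: finite_seq].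
Qed.

Lemma finite_tconsts (U : Type) k (t : term U k) : finite_set (tconsts t).
Proof. by case: t => [j|a]; [exact: finite_set0|exact: finite_set1]. Qed.

Lemma finite_consts (U : Type) n (ar : 'I_n -> nat) k (f : formula U ar k) :
  finite_set (consts f).
Proof.
elim: f => {k} /= [k i s|k s t|//|k f F g G|k f F g G|//|//].
- have -> : [set a | exists j, tconsts (tnth s j) a] =
    \bigcup_(j in [set: 'I_(ar i)]) tconsts (tnth s j).
    by apply/seteqP; split=> a; [case=> j ?; exists j|case=> j _ ?; exists j].
  by apply: bigcup_finite => [|j _]; [exact: finite_finset|exact: finite_tconsts].
- by rewrite finite_setU; split; exact: finite_tconsts.
- by rewrite finite_setU.
- by rewrite finite_setU.
Qed.

Lemma finite_tuples (U : choiceType) k (D : set U) : finite_set D ->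
  finite_set [set t : k.-tuple U | forall j, D (tnth t j)].
Proof.
move=> /finite_seqP[s ->].
apply: (@sub_finite_set _ _
  (range (fun t : k.-tuple (seq_sub s) => map_tuple val t))).
  move=> t /= st.
  exists [tuple SeqSub (st j) | j < k] => //.
  by apply: eq_from_tnth => j; rewrite tnth_map tnth_mktuple.
by apply: finite_image; exact: finite_finset.
Qed.

Lemma finite_answers (U : choiceType) n (ar : 'I_n -> nat) (B : db U ar)
    k (f : formula U ar k) : domain_independent f -> finite_set (answers B f).
Proof.
move=> dif; case: (pselect (exists a : U, True)) => [[a _]|noU]; last first.
  case: k f dif => [f _|k f _].
    apply: (@sub_finite_set _ _ [set [tuple]]); last exact: finite_set1.
    by move=> t _; rewrite /= (tuple0 t).
  apply: (@sub_finite_set _ _ set0); last exact: finite_set0.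
  by move=> t _; case: noU; exists (thead t).
pose D := a |` (adom B `|` consts f).
have finD : finite_set D.
  rewrite !finite_setU; split; first exact: finite_set1.
  by split; [exact: finite_adom|exact: finite_consts].
apply: (sub_finite_set _ (finite_tuples k finD)) => t ft.
have : answers_in setT B f t by [].
rewrite (dif B setT D) => [[]//| | |//|]; first by exists a.
  by exists a; left.
by move=> x Dx; right.
Qed.

Lemma finite_dfwith (U : Type) n (ar : 'I_n -> nat) (B : db U ar) (r : 'I_n)
    (X : set ((ar r).-tuple U)) (finX : finite_set X) (i : 'I_n) :
  finite_set (@dfwith _ (fun i => set ((ar i).-tuple U)) B r X i).
Proof. by case: dfwithP => [//|j _]; exact: rel_finite. Qed.

(* B[R -> X] *)
Definition db_set (U : Type) n (ar : 'I_n -> nat) (B : db U ar) (r : 'I_n)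
    (X : set ((ar r).-tuple U)) (finX : finite_set X) : db U ar :=
  Db (finite_dfwith B finX).

Lemma finite_insert (U : choiceType) n (ar : 'I_n -> nat) (B : db U ar)
    (r : 'I_n) (Phi : formula U ar (ar r)) :
  domain_independent Phi -> finite_set (B r `|` answers B Phi).
Proof.
by move=> di; rewrite finite_setU; split; [exact: rel_finite|exact: finite_answers].
Qed.

Lemma finite_delete (U : Type) n (ar : 'I_n -> nat) (B : db U ar)
    (r : 'I_n) (Phi : formula U ar (ar r)) :
  finite_set (B r `\` answers B Phi).
Proof. by apply: finite_setD; exact: rel_finite. Qed.

Inductive instr (U : eqType) {n : nat} (ar : 'I_n -> nat) : Type :=
| Insert (r : 'I_n) (Phi : formula U ar (ar r)) of domain_independent Phi
| Delete (r : 'I_n) (Phi : formula U ar (ar r)) of domain_independent Phi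
| Seq of instr U ar & instr U ar
| IfThenElse (cond : sentence U ar) of domain_independent cond &
    instr U ar & instr U ar
| IfThen (cond : sentence U ar) of domain_independent cond & instr U ar.

Fixpoint exec (U : choiceType) n (ar : 'I_n -> nat) (i : instr U ar)
    (B : db U ar) : db U ar :=
  match i with
  | Insert r Phi di => db_set B (finite_insert B di)
  | Delete r Phi _ => db_set B (finite_delete B Phi)
  | Seq i1 i2 => exec i2 (exec i1 B)
  | IfThenElse cond _ i1 i2 =>
      if `[< models B cond >] then exec i1 B else exec i2 B
  | IfThen cond _ i1 => if `[< models B cond >] then exec i1 B else B
  end.

Definition tshift (U : Type) k (t : term U k) : term U k.+1 :=
  match t with Var j => Var (lift ord0 j) | Cst a => Cst a end.

Definition tsubst (U : Type) k m (s : k.-tuple (term U m)) (t : term U k)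
    : term U m :=
  match t with Var j => tnth s j | Cst a => Cst a end.

Definition up (U : Type) k m (s : k.-tuple (term U m))
    : k.+1.-tuple (term U m.+1) :=
  [tuple of Var ord0 :: map_tuple (@tshift U m) s].

(* phi(s_0, ..., s_(k-1)), simultaneous and capture-avoiding *)
Fixpoint fsubst (U : Type) n (ar : 'I_n -> nat) k (f : formula U ar k)
    : forall m, k.-tuple (term U m) -> formula U ar m :=
  match f with
  | FRel _ i t => fun m s => FRel i (map_tuple (tsubst s) t)
  | FEq _ t u => fun m s => FEq (tsubst s t) (tsubst s u)
  | FNot _ f => fun m s => FNot (fsubst f s)
  | FAnd _ f g => fun m s => FAnd (fsubst f s) (fsubst g s)
  | FOr _ f g => fun m s => FOr (fsubst f s) (fsubst g s)
  | FEx _ f => fun m s => FEx (fsubst f (up s))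
  | FAll _ f => fun m s => FAll (fsubst f (up s))
  end.

(* Replaces every atom r(s) of the formula by op (r(s)) (phi(s)). *)
Fixpoint replace_atoms (U : Type) n (ar : 'I_n -> nat)
    (op : forall k, formula U ar k -> formula U ar k -> formula U ar k)
    (r : 'I_n) (phi : formula U ar (ar r)) k (f : formula U ar k)
    : formula U ar k :=
  match f with
  | FRel _ i s =>
      match i =P r with
      | ReflectT e => op _ (FRel i s) (fsubst phi (tcast (congr1 ar e) s))
      | ReflectF _ => FRel i s
      end
  | FEq _ t u => FEq t u
  | FNot _ f => FNot (replace_atoms op phi f)
  | FAnd _ f g => FAnd (replace_atoms op phi f) (replace_atoms op phi g)
  | FOr _ f g => FOr (replace_atoms op phi f) (replace_atoms op phi g)
  | FEx _ f => FEx (replace_atoms op phi f)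
  | FAll _ f => FAll (replace_atoms op phi f)
  end.

(* c[r -> r \cup phi] *)
Definition replace_union (U : Type) n (ar : 'I_n -> nat) (r : 'I_n)
    (phi : formula U ar (ar r)) k (c : formula U ar k) : formula U ar k :=
  replace_atoms (fun _ a b => FOr a b) phi c.

(* c[r -> r - phi] *)
Definition replace_diff (U : Type) n (ar : 'I_n -> nat) (r : 'I_n)
    (phi : formula U ar (ar r)) k (c : formula U ar k) : formula U ar k :=
  replace_atoms (fun _ a b => FAnd a (FNot b)) phi c.

Definition precondition (U : Type) n (ar : 'I_n -> nat)
    (u : db U ar -> db U ar) (c f : sentence U ar) : Prop :=
  forall B, models B f -> models (u B) c.

Definition weaker (U : Type) n (ar : 'I_n -> nat) (f g : sentence U ar)
    : Prop :=
  forall B, models B g -> models B f.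

Definition weakest_precondition (U : Type) n (ar : 'I_n -> nat)
    (u : db U ar -> db U ar) (c f : sentence U ar) : Prop :=
  precondition u c f /\ (forall g, precondition u c g -> weaker f g).

(* Main.v *)
(* Every instruction u and constraint c admit a sentence f that is exact: B |= f
   iff u(B) |= c.  An exact sentence is a weakest precondition, and comparing
   an arbitrary weakest precondition with it shows that the former is exact as
   well.  The four clauses thus reduce to the exactness of the given formulas;
   for insertions and deletions this is the substitution lemma of first-order
   logic. *)

Require Import Defs.
From mathcomp Require Import all_boot.
From mathcomp Require Import boolp classical_sets cardinality.

Local Open Scope classical_set_scope.

Definition exact_precondition {U : Type} {n : nat} {ar : 'I_n -> nat}
    (u : db U ar -> db U ar) (c f : sentence U ar) : Prop :=
  forall B, models B f <-> models (u B) c.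

Lemma exact_weakest {U : Type} {n : nat} {ar : 'I_n -> nat}
    {u : db U ar -> db U ar} {c f : sentence U ar} :
  exact_precondition u c f -> weakest_precondition u c f.
Proof. by move=> uf; split=> [B /uf//|g ug B /ug /uf]. Qed.

(** The exact [h] is itself a precondition, so [f] is weaker than [h]; this yields the way back from
    [u B] to [B]. *)
Lemma weakest_exact {U : Type} {n : nat} {ar : 'I_n -> nat}
    {u : db U ar -> db U ar} {c f h : sentence U ar} :
  exact_precondition u c h -> weakest_precondition u c f ->
  exact_precondition u c f.
Proof.
move=> uh [uf wf] B; split; first exact: uf.
by move=> /uh; apply: wf => {}B /uh.
Qed.

Lemma teval_subst {U : Type} {k m : nat} (s : k.-tuple (term U m))
    (e : m.-tuple U) (t : term U k) :
  teval e (tsubst s t) = teval (map_tuple (teval e) s) t.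
Proof. by case: t => [j|a] //=; rewrite tnth_map. Qed.

Lemma teval_shift {U : Type} {k : nat} (a : U) (e : k.-tuple U)
    (t : term U k) :
  teval [tuple of a :: e] (tshift t) = teval e t.
Proof. by case: t => [j|b] //=; rewrite tnthS. Qed.

(** Carries the substitution lemma under a quantifier: shifted terms ignore the new value [a], and
    variable 0 receives it. *)
Lemma map_teval_up {U : Type} {k m : nat} (s : k.-tuple (term U m)) (a : U)
    (e : m.-tuple U) :
  map_tuple (teval [tuple of a :: e]) (up s) =
  [tuple of a :: map_tuple (teval e) s].
Proof.
apply: val_inj => /=; congr cons; rewrite -map_comp.
by apply: eq_map => t /=; rewrite teval_shift.
Qed.

(** The substitution lemma. Both [s] and [e] stay general in the induction, since each quantifier
    extends them. *)
Lemma sat_in_subst {U : Type} {n : nat} {ar : 'I_n -> nat} (D : set U)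
    (B : db U ar) {k : nat} (f : formula U ar k) (m : nat)
    (s : k.-tuple (term U m)) (e : m.-tuple U) :
  sat_in D B (fsubst f s) e <-> sat_in D B f (map_tuple (teval e) s).
Proof.
elim: f m s e => {k} /= [k i t|k t u|k f F|k f F g G|k f F g G|k f F|k f F] m s e.
- suff -> : map_tuple (teval e) (map_tuple (tsubst s) t) =
            map_tuple (teval (map_tuple (teval e) s)) t by [].
  by apply: eq_from_tnth => j; rewrite !tnth_map teval_subst.
- by rewrite !teval_subst.
- by rewrite F.
- by rewrite F G.
- by rewrite F G.
- by split=> -[a Da fa]; exists a => //; move: fa; rewrite F map_teval_up.
- by split=> fa a Da; move: (fa a Da); rewrite F map_teval_up.
Qed.

(** Serves insertion and deletion at once: [op] only has to express membership in [X] at the atoms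
    of [r]. The other relations, and the range [U] of the quantifiers, are the same in both
    databases. *)
Lemma sat_replace_atoms {U : Type} {n : nat} {ar : 'I_n -> nat}
    (op : forall k, formula U ar k -> formula U ar k -> formula U ar k)
    (B : db U ar) (r : 'I_n) (phi : formula U ar (ar r))
    (X : set ((ar r).-tuple U)) (finX : finite_set X) :
  (forall k (s : (ar r).-tuple (term U k)) (e : k.-tuple U),
    sat B (op k (FRel r s) (fsubst phi s)) e <-> X (map_tuple (teval e) s)) ->
  forall k (f : formula U ar k) (e : k.-tuple U),
    sat B (replace_atoms op phi f) e <-> sat (db_set B finX) f e.
Proof.
rewrite /sat => opX k f.
elim: f => {k} /= [k i s|k s t|k f F|k f F g G|k f F g G|k f F|k f F] e.
- case: eqP => [ir|/eqP ir] /=; last by rewrite dfwith_out // eq_sym.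
  (* Once [i] is [r], the cast runs along an equation between identical terms, and uniqueness of
     equality proofs removes it. *)
  by subst i; rewrite eq_axiomK tcast_id dfwith_in opX.
- by [].
- by rewrite F.
- by rewrite F G.
- by rewrite F G.
- by split=> -[a Da /F fa]; exists a.
- by split=> fa a Da; apply/F; exact: fa.
Qed.

Lemma exact_insert {U : choiceType} {n : nat} {ar : 'I_n -> nat} {r : 'I_n}
    {Phi : formula U ar (ar r)} (di : domain_independent Phi)
    (c : sentence U ar) :
  exact_precondition (exec (Insert di)) c (replace_union Phi c).
Proof.
by move=> B; apply: sat_replace_atoms => k s e; rewrite /sat /= sat_in_subst.
Qed.

Lemma exact_delete {U : choiceType} {n : nat} {ar : 'I_n -> nat} {r : 'I_n}
    {Phi : formula U ar (ar r)} (di : domain_independent Phi)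
    (c : sentence U ar) :
  exact_precondition (exec (Delete di)) c (replace_diff Phi c).
Proof.
by move=> B; apply: sat_replace_atoms => k s e; rewrite /sat /= sat_in_subst.
Qed.

Lemma exact_seq {U : choiceType} {n : nat} {ar : 'I_n -> nat}
    {i1 i2 : instr U ar} {c g f : sentence U ar} :
  exact_precondition (exec i2) c g -> exact_precondition (exec i1) g f ->
  exact_precondition (exec (Seq i1 i2)) c f.
Proof. by move=> ig jf B; rewrite jf ig. Qed.

(** Stated for arbitrary maps, so that [u2] can also be the identity of a missing else-branch. *)
Lemma exact_cond {U : Type} {n : nat} {ar : 'I_n -> nat}
    {u1 u2 : db U ar -> db U ar} {cond c f1 f2 : sentence U ar} :
  exact_precondition u1 c f1 -> exact_precondition u2 c f2 ->
  exact_precondition (fun B => if `[< models B cond >] then u1 B else u2 B) c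
    (FOr (FAnd cond f1) (FAnd (FNot cond) f2)).
Proof.
(* Satisfaction unfolds by conversion to a propositional combination, in which the two equivalences
   can be rewritten. *)
move=> uf1 uf2 B; rewrite -[models B (FOr _ _)]/((models B cond /\ models B f1)
  \/ (~ models B cond /\ models B f2)) uf1 uf2.
by case: asboolP => b; tauto.
Qed.

(** Induction on [i] for all [c]: in a sequence, the sentence found for [i2] becomes the constraint
    for [i1]. *)
Lemma exact_precondition_exists {U : choiceType} {n : nat} {ar : 'I_n -> nat}
    (i : instr U ar) (c : sentence U ar) :
  exists f, exact_precondition (exec i) c f.
Proof.
elim: i c => [r Phi di|r Phi di|i1 IH1 i2 IH2|cond di i1 IH1 i2 IH2|cond di i IH] c.
- by exists (replace_union Phi c); exact: exact_insert.
- by exists (replace_diff Phi c); exact: exact_delete.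
- have [g ig] := IH2 c; have [f jf] := IH1 g.
  by exists f; exact: exact_seq ig jf.
- have [f1 if1] := IH1 c; have [f2 if2] := IH2 c.
  by eexists; exact: exact_cond if1 if2.
- have [f1 if1] := IH c.
  (* Without an else-branch the database is unchanged, and [c] is exact for the identity. *)
  by eexists; apply: (exact_cond if1 (u2 := id) (f2 := c)).
Qed.

(** A weakest precondition is unique only up to equivalence, so the recursive clauses range over
    every choice of it; the existence claims keep them from being vacuous. *)
Theorem theorem1 (U : countType) (hU : infinite_set [set: U])
    (n : nat) (ar : 'I_n -> nat)
    (c : sentence U ar) (hc : domain_independent c)
    (r : 'I_n) (Phi : formula U ar (ar r)) (hPhi : domain_independent Phi)
    (cond : sentence U ar) (hcond : domain_independent cond)
    (i1 i2 inst1 inst2 : instr U ar) :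
  [/\ weakest_precondition (exec (Insert hPhi)) c (replace_union Phi c),
      weakest_precondition (exec (Delete hPhi)) c (replace_diff Phi c),
      (exists g, weakest_precondition (exec i2) c g) /\
      (forall g, weakest_precondition (exec i2) c g ->
        (exists f, weakest_precondition (exec i1) g f) /\
        (forall f, weakest_precondition (exec i1) g f ->
          weakest_precondition (exec (Seq i1 i2)) c f))
    & [/\ exists f1, weakest_precondition (exec inst1) c f1,
          exists f2, weakest_precondition (exec inst2) c f2
        & forall f1 f2,
          weakest_precondition (exec inst1) c f1 ->
          weakest_precondition (exec inst2) c f2 ->
          weakest_precondition (exec (IfThenElse hcond inst1 inst2)) c
            (FOr (FAnd cond f1) (FAnd (FNot cond) f2))]].
Proof.
have exi i d : exists f, weakest_precondition (exec i) d f.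
  by have [f /exact_weakest wf] := exact_precondition_exists i d; exists f.
(* Turns each chosen weakest precondition into an equivalence, and equivalences compose. *)
have wpE i d f : weakest_precondition (exec i) d f ->
    exact_precondition (exec i) d f.
  by have [h /weakest_exact] := exact_precondition_exists i d; apply.
split.
- exact/exact_weakest/exact_insert.
- exact/exact_weakest/exact_delete.
- split=> // g /wpE i2g; split=> // f /wpE i1f.
  exact/exact_weakest/(exact_seq i2g i1f).
- split=> // f1 f2 /wpE if1 /wpE if2.
  exact/exact_weakest/(exact_cond if1 if2).
Qed.
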